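(* Let $X\sim \mathrm{mPH}(\boldsymbol{\pi},\mathcal{T})$ with $\mathcal{T}=\{\boldsymbol{T}_1,\dots,\boldsymbol{T}_d\}$, and for $x\in\mathbb{R}_+^d$ let $F_X(x)=\mathbb{P}(X_1\le x_1,\dots,X_d\le x_d)$ and $S_X(x)=\mathbb{P}(X_1>x_1,\dots,X_d>x_d)$. Then $$F_X(x)=\sum_{j=1}^p\pi_j\prod_{i=1}^d\left(1-\boldsymbol{e}_j^{\mathsf{T}}\exp(\boldsymbol{T}_i x_i)\boldsymbol{e}\right),\qquad x\in\mathbb{R}_+^d.$$ Moreover, $$S_X(x)=\mathbb{P}(Y(x)>1),\qquad x\in\mathbb{R}_+^d,$$ where $Y(x)\sim\mathrm{PH}(\tilde{\boldsymbol{\pi}},\boldsymbol{T}(x))$ is univariate phase-type with $$\tilde{\boldsymbol{\pi}}=\left(\pi_1(\boldsymbol{e}_1^{\mathsf{T}}\otimes\cdots\otimes\boldsymbol{e}_1^{\mathsf{T}}),\dots,\pi_p(\boldsymbol{e}_p^{\mathsf{T}}\otimes\cdots\otimes\boldsymbol{e}_p^{\mathsf{T}})\right)$$ (each Kronecker product having $d$ factors), and $\boldsymbol{T}(x)$ is the block-diagonal matrix with $p$ diagonal blocks, each equal to $\boldsymbol{T}_1x_1\oplus\cdots\oplus\boldsymbol{T}_dx_d$.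
   Context: Notation: $\mathbb{R}_+=(0,\infty)$; $\otimes$ and $\oplus$ denote the Kronecker product and Kronecker sum of matrices ($A\oplus B=A\otimes I+I\otimes B$, iterated for several terms); $\boldsymbol{e}_j$ is the $j$-th canonical basis (column) vector of $\mathbb{R}^p$ and $\boldsymbol{e}=\sum_{j=1}^p\boldsymbol{e}_j$. mPH class. Let $\boldsymbol{\pi}=(\pi_1,\dots,\pi_p)$ be a probability row vector and let $\boldsymbol{T}_1,\dots,\boldsymbol{T}_d$ be real $p\times p$ sub-intensity matrices (nonnegative off-diagonal entries, strictly negative diagonal entries, nonpositive row sums) for which all states $1,\dots,p$ are transient (equivalently, each $\boldsymbol{T}_i$ is invertible). Let $\boldsymbol{t}_i=-\boldsymbol{T}_i\boldsymbol{e}$. For $i=1,\dots,d$ let $(J^{(i)}_t)_{t\ge 0}$ be a time-homogeneous Markov jump process on $\{1,\dots,p,p+1\}$ with $p+1$ absorbing, with transition intensities between the states $1,\dots,p$ given by $\boldsymbol{T}_i$ and intensities of jumping to $p+1$ given by $\boldsymbol{t}_i$. Assume that all the processes start in the same state, $J_0^{(1)}=\dots=J_0^{(d)}=:J_0$ with $\mathbb{P}(J_0=j)=\pi_j$ for $j=1,\dots,p$, and that the $d$ processes are conditionally independent given $J_0$. Put $X_i=\inf\{t>0: J^{(i)}_t=p+1\}$. Then $X=(X_1,\dots,X_d)$ is said to be mPH (multivariate phase-type) distributed, written $X\sim \mathrm{mPH}(\boldsymbol{\pi},\mathcal{T})$ with $\mathcal{T}=\{\boldsymbol{T}_1,\dots,\boldsymbol{T}_d\}$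 (indexed by $i=1,\dots,d$). Univariate phase-type: $\mathrm{PH}(\boldsymbol{\alpha},\boldsymbol{S})$, for a probability row vector $\boldsymbol{\alpha}$ of length $q$ and a $q\times q$ sub-intensity matrix $\boldsymbol{S}$ with all states transient, is the distribution of the absorption time of a Markov jump process on $\{1,\dots,q,q+1\}$ with $q+1$ absorbing, initial distribution $\boldsymbol{\alpha}$ on $\{1,\dots,q\}$ and transition intensities among $\{1,\dots,q\}$ given by $\boldsymbol{S}$. *)

(* Defs.v *)
From HB Require Import structures.
From mathcomp Require Import all_boot all_order all_algebra.
From mathcomp Require Import all_classical all_reals all_analysis measurable_realfun.
From mathcomp Require Export mxtens.

Set Implicit Arguments.
Unset Strict Implicit.
Unset Printing Implicit Defensive.

Import Order.TTheory GRing.Theory Num.Theory numFieldNormedType.Exports.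

Local Open Scope classical_set_scope.
Local Open Scope ring_scope.

Definition expmx (R : realType) (n : nat) (A : 'M[R]_n) : 'M[R]_n :=
  \matrix_(i, j)
    limn (fun N => (\sum_(0 <= k < N) (k`!%:R)^-1 *: A ^+ k) i j).

(* p ^ d, presented so that [powdim p d.+1] is convertible to
   [p * powdim p d]; this avoids casts in the Kronecker operations. *)
Definition powdim (p d : nat) : nat := iter d (muln p) 1%N.

(* a_0 (x) ... (x) a_{d-1} for row vectors *)
Fixpoint kron_row (R : realType) (p d : nat) :
    ('I_d -> 'rV[R]_p) -> 'rV[R]_(powdim p d) :=
  match d with
  | 0 => fun _ => const_mx 1
  | d'.+1 => fun a =>
      (a ord0 *t kron_row (fun i => a (lift ord0 i))
        : 'M[R]_(1 * 1, p * powdim p d'))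
  end.

(* A_0 (+) ... (+) A_{d-1}, with A (+) B = A (x) I + I (x) B; the empty sum is
   the 1 x 1 zero matrix, which is neutral for (+). *)
Fixpoint kron_sum (R : realType) (p d : nat) :
    ('I_d -> 'M[R]_p) -> 'M[R]_(powdim p d) :=
  match d with
  | 0 => fun _ => 0
  | d'.+1 => fun A =>
      A ord0 *t 1%:M + 1%:M *t kron_sum (fun i => A (lift ord0 i))
  end.

Definition probability_vector (R : realType) (n : nat) (a : 'rV[R]_n) : Prop :=
  (forall j, 0 <= a 0 j) /\ \sum_j a 0 j = 1.

Definition sub_intensity (R : realType) (n : nat) (S : 'M[R]_n) : Prop :=
  [/\ forall j k, j != k -> 0 <= S j k,
      forall j, S j j < 0 &
      forall j, \sum_k S j k <= 0].

(* All states of a sub-intensity matrix are transient iff it is invertible. *)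
Definition transient_sub_intensity (R : realType) (n : nat) (S : 'M[R]_n) :
    Prop :=
  sub_intensity S /\ S \in unitmx.

(* In 'I_(n + 1) the transient states are the [lshift 1 j] for [j : 'I_n]; the
   remaining (last) state is the absorbing one. *)
Definition absorbing (n : nat) : 'I_(n + 1) := rshift n ord0.

Definition absorbing_generator (R : realType) (n : nat) (S : 'M[R]_n) :
    'M[R]_(n + 1) :=
  block_mx S (- (S *m const_mx 1)) 0 0.

(* [Q] is a standard transition semigroup of stochastic matrices, with
   transition intensities [L]: Q h = I + h L + o(h) as h tends to 0+. *)
Definition transition_semigroup (R : realType) (n : nat) (L : 'M[R]_n)
    (Q : R -> 'M[R]_n) : Prop :=
  [/\ Q 0 = 1%:M,
      forall s t, 0 <= s -> 0 <= t -> Q (s + t) = Q s *m Q t,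
      forall t, 0 <= t -> forall j, probability_vector (row j (Q t)) &
      forall j k, (Q h j k - (1%:M : 'M[R]_n) j k) / h @[h --> 0^'+] --> L j k].

(* Processes on a finite set 'I_n are maps [J : R -> Omega -> 'I_n], of which
   only the values at times t >= 0 matter. *)

(* the sigma-algebra generated by the J t, t in D *)
Definition process_sigma (R : realType) (Omega : Type) (n : nat)
    (J : R -> Omega -> 'I_n) (D : set R) : set (set Omega) :=
  <<s [set A | exists t k, D t /\ A = J t @^-1` [set k]] >>.

(* The last two conditions say that paths are right-continuous with left limits
   for the discrete topology, i.e. piecewise constant with finitely many jumps
   on bounded intervals. *)
Definition jump_process (R : realType) (disp : measure_display)
    (Omega : measurableType disp) (n : nat) (J : R -> Omega -> 'I_n) : Prop :=
  [/\ forall t k, 0 <= t -> measurable (J t @^-1` [set k]),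
      forall w t, 0 <= t -> \forall s \near t^'+, J s w = J t w &
      forall w t, 0 < t -> exists k, \forall s \near t^'-, J s w = k].

(* Time-homogeneous Markov property; multiplied out, so that conditioning on a
   null event imposes nothing. *)
Definition markov_with (R : realType) (disp : measure_display)
    (Omega : measurableType disp) (P : probability Omega R) (n : nat)
    (Q : R -> 'M[R]_n) (J : R -> Omega -> 'I_n) : Prop :=
  forall (s t : R) (A : set Omega) (j k : 'I_n), 0 <= s -> 0 <= t ->
    process_sigma J [set u | 0 <= u <= s] A ->
    P (A `&` J s @^-1` [set j] `&` J (s + t) @^-1` [set k]) =
    (P (A `&` J s @^-1` [set j]) * (Q t j k)%:E)%E.

Definition markov_jump_process (R : realType) (disp : measure_display)
    (Omega : measurableType disp) (P : probability Omega R) (n : nat)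
    (L : 'M[R]_n) (J : R -> Omega -> 'I_n) : Prop :=
  jump_process J /\
  exists Q : R -> 'M[R]_n, transition_semigroup L Q /\ markov_with P Q J.

(* inf {t > 0 : J t = absorbing state}, equal to +oo if the set is empty *)
Definition absorption_time (R : realType) (Omega : Type) (n : nat)
    (J : R -> Omega -> 'I_(n + 1)) (w : Omega) : \bar R :=
  ereal_inf [set t%:E | t in [set t : R | 0 < t /\ J t w = absorbing n]].

Definition cond_prob (R : realType) (disp : measure_display)
    (Omega : measurableType disp) (P : probability Omega R)
    (A B : set Omega) : R :=
  fine (P (A `&` B)) / fine (P B).

Definition cond_indep_given_start (R : realType) (disp : measure_display)
    (Omega : measurableType disp) (P : probability Omega R) (n d : nat)
    (J : 'I_d -> R -> Omega -> 'I_n) (J0 : Omega -> 'I_n) : Prop :=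
  forall (j : 'I_n) (A : 'I_d -> set Omega),
    (0 < P (J0 @^-1` [set j]))%E ->
    (forall i, process_sigma (J i) [set t | 0 <= t] (A i)) ->
    cond_prob P [set w | forall i, A i w] (J0 @^-1` [set j]) =
    \prod_(i < d) cond_prob P (A i) (J0 @^-1` [set j]).

Definition mPH_processes (R : realType) (disp : measure_display)
    (Omega : measurableType disp) (P : probability Omega R) (p d : nat)
    (pi : 'rV[R]_p) (T : 'I_d -> 'M[R]_p)
    (J : 'I_d -> R -> Omega -> 'I_(p + 1)) : Prop :=
  (forall i, markov_jump_process P (absorbing_generator (T i)) (J i)) /\
  exists J0 : Omega -> 'I_(p + 1),
    [/\ forall i w, J i 0 w = J0 w,
        forall j : 'I_p, P (J0 @^-1` [set lshift 1 j]) = (pi 0 j)%:E &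
        cond_indep_given_start P J J0].

(* X ~ mPH(pi, T): X has the same joint law as a vector of absorption times as
   above; laws on \bar R ^ d are compared on measurable rectangles, which
   determine them. That (pi, T) are admissible parameters is not part of this
   predicate, nor of [PH] below. *)
Definition mPH (R : realType) (disp : measure_display)
    (Omega : measurableType disp) (P : probability Omega R) (p d : nat)
    (pi : 'rV[R]_p) (T : 'I_d -> 'M[R]_p)
    (X : 'I_d -> {RV P >-> \bar R}) : Prop :=
  exists (disp' : measure_display) (Omega' : measurableType disp')
    (P' : probability Omega' R) (J : 'I_d -> R -> Omega' -> 'I_(p + 1)),
    mPH_processes P' pi T J /\
    forall B : 'I_d -> set (\bar R), (forall i, measurable (B i)) ->
      P [set w | forall i, B i (X i w)] =
      P' [set w | forall i, B i (absorption_time (J i) w)].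

(* Y ~ PH(alpha, S), again as equality in law with an absorption time. *)
Definition PH (R : realType) (disp : measure_display)
    (Omega : measurableType disp) (P : probability Omega R) (q : nat)
    (alpha : 'rV[R]_q) (S : 'M[R]_q) (Y : {RV P >-> \bar R}) : Prop :=
  exists (disp' : measure_display) (Omega' : measurableType disp')
    (P' : probability Omega' R) (K : R -> Omega' -> 'I_(q + 1)),
    [/\ markov_jump_process P' (absorbing_generator S) K,
        forall j : 'I_q,
          P' (K 0 @^-1` [set lshift 1 j]) = (alpha 0 j)%:E &
        forall B : set (\bar R), measurable B ->
          P (Y @^-1` B) = P' (absorption_time K @^-1` B)].

Definition joint_cdf (R : realType) (disp : measure_display)
    (Omega : measurableType disp) (P : probability Omega R) (d : nat)
    (X : 'I_d -> {RV P >-> \bar R}) (x : 'I_d -> R) : \bar R :=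
  P [set w | forall i, (X i w <= (x i)%:E)%E].

Definition joint_survival (R : realType) (disp : measure_display)
    (Omega : measurableType disp) (P : probability Omega R) (d : nat)
    (X : 'I_d -> {RV P >-> \bar R}) (x : 'I_d -> R) : \bar R :=
  P [set w | forall i, ((x i)%:E < X i w)%E].

Definition basis_row (R : realType) (p : nat) (j : 'I_p) : 'rV[R]_p :=
  delta_mx 0 j.

Definition ones (R : realType) (p : nat) : 'cV[R]_p := const_mx 1.

Definition pi_tilde (R : realType) (p d : nat) (pi : 'rV[R]_p) :
    'rV[R]_(\sum_(j < p) powdim p d) :=
  \mxrow_(j < p) (pi 0 j *: kron_row (fun _ : 'I_d => basis_row R j)).

Definition T_of (R : realType) (p d : nat) (T : 'I_d -> 'M[R]_p)
    (x : 'I_d -> R) : 'M[R]_(\sum_(j < p) powdim p d) :=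
  \mxdiag_(j < p) kron_sum (fun i => x i *: T i).

(* Main.v *)
Require Import Defs.
From HB Require Import structures.
From mathcomp Require Import all_boot all_order all_algebra.
From mathcomp Require Import all_classical all_reals all_analysis measurable_realfun.
From mathcomp Require Import ring lra.

Set Implicit Arguments.
Unset Strict Implicit.
Unset Printing Implicit Defensive.

Import Order.TTheory GRing.Theory Num.Theory numFieldNormedType.Exports.

Local Open Scope classical_set_scope.
Local Open Scope ring_scope.

(** Let f be a matrix semigroup on [0, oo) with f(h) = I + h L + o(h) at 0+.
    Telescoping f(t/N)^N - (I + t L/N)^N in the row-sum norm shows that
    f(t) = lim (I + t L/N)^N, and comparing binomial coefficients shows that
    this limit is the exponential series of t L. So such a semigroup is determined by
    its generator, and no further theory of the matrix exponential is needed.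

    This applies to the transient block f_i of the transition semigroup of each
    J^(i), and right-continuity of paths gives, up to a null set, that
    {X_i <= t} is {J^(i)_t absorbed}; conditioning on J_0 yields both F_X and
    S_X(x) = sum_j pi_j prod_i sum_k f_i(x_i)_jk. The Kronecker product of the
    t |-> f_i(x_i t) is a semigroup generated by the Kronecker sum of the
    x_i T_i, hence computes P(Y(x) > 1).

    Invertibility of T(x) comes from a minimum principle: a sub-intensity matrix
    S is invertible iff S v < 0 for some v > 0, and such vectors v can be
    tensored. *)

(** * The row-sum norm on square matrices *)

Definition row_bound (R : realType) (n : nat) (A : 'M[R]_n) (c : R) : Prop :=
  forall i, \sum_j `|A i j| <= c.

Section RowBound.
Variables (R : realType) (n : nat).
Implicit Types (A B : 'M[R]_n) (c e : R).

Lemma row_bound_entry A c i j : row_bound A c -> `|A i j| <= c.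
Proof.
move=> /(_ i); apply: le_trans.
by rewrite (bigD1 j)//= lerDl sumr_ge0.
Qed.

Lemma row_bound1 : row_bound (1 : 'M[R]_n) 1.
Proof.
move=> i; rewrite (bigD1 i)//= mxE eqxx normr1 big1 ?addr0// => j ji.
by rewrite mxE eq_sym (negbTE ji) normr0.
Qed.

Lemma row_boundD A B c e :
  row_bound A c -> row_bound B e -> row_bound (A + B) (c + e).
Proof.
move=> hA hB i; apply: le_trans (lerD (hA i) (hB i)).
by rewrite -big_split; apply: ler_sum => j _ /=; rewrite mxE ler_normD.
Qed.

Lemma row_boundZ A c x : row_bound A c -> row_bound (x *: A) (`|x| * c).
Proof.
move=> hA i; apply: le_trans (ler_wpM2l (normr_ge0 x) (hA i)).
by rewrite mulr_sumr; apply: ler_sum => j _; rewrite mxE normrM.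
Qed.

Lemma row_boundM A B c e :
  0 <= e -> row_bound A c -> row_bound B e -> row_bound (A * B) (c * e).
Proof.
move=> e0 hA hB i; apply: le_trans (ler_wpM2r e0 (hA i)).
under eq_bigr do rewrite mxE.
apply: (@le_trans _ _ (\sum_j \sum_k `|A i k * B k j|)).
  by apply: ler_sum => j _; exact: ler_norm_sum.
rewrite exchange_big mulr_suml; apply: ler_sum => k _ /=.
under eq_bigr do rewrite normrM.
by rewrite -mulr_sumr ler_wpM2l.
Qed.

Lemma row_boundX A c k : 0 <= c -> row_bound A c -> row_bound (A ^+ k) (c ^+ k).
Proof.
move=> c0 hA; elim: k => [|k IH]; first by rewrite !expr0; exact: row_bound1.
by rewrite !exprS; apply: row_boundM => //; exact: exprn_ge0.
Qed.

Lemma row_bound_le A c e : c <= e -> row_bound A c -> row_bound A e.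
Proof. by move=> ce hA i; exact: le_trans (hA i) ce. Qed.

(** Telescoping: each of the k terms contains one factor [A - B]. The power [m ^+ k] is one higher
    than necessary; with [1 <= m] this slack avoids [k.-1]. *)
Lemma row_bound_subX A B m e k : 1 <= m -> 0 <= e ->
  row_bound A m -> row_bound B m -> row_bound (A - B) e ->
  row_bound (A ^+ k - B ^+ k) (k%:R * m ^+ k * e).
Proof.
move=> m1 e0 hA hB hAB; have m0 : 0 <= m by apply: le_trans m1.
elim: k => [|k IH].
  by rewrite !expr0 subrr !mul0r => i; rewrite big1// => j _; rewrite mxE normr0.
have -> : A ^+ k.+1 - B ^+ k.+1 = A * (A ^+ k - B ^+ k) + (A - B) * B ^+ k.
  by rewrite mulrBr mulrBl !exprS addrA subrK.
have mk0 : 0 <= m ^+ k by exact: exprn_ge0.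
apply: row_bound_le (row_boundD (row_boundM _ hA IH)
  (row_boundM mk0 hAB (row_boundX k m0 hB))).
  rewrite exprS -[k.+1]addn1 natrD.
  have : e * m ^+ k <= m * (e * m ^+ k) by rewrite ler_peMl// mulr_ge0.
  lra.
by rewrite !mulr_ge0.
Qed.

Lemma row_bound_exists A : exists2 c, 0 <= c & row_bound A c.
Proof.
exists (\sum_i \sum_j `|A i j|); first by do 2!apply: sumr_ge0 => ? _.
by move=> i; rewrite [leRHS](bigD1 i)//= lerDl; do 2!apply: sumr_ge0 => ? _.
Qed.

End RowBound.

(** * Matrix semigroups as limits of Euler products *)

Definition euler (R : realType) (n : nat) (L : 'M[R]_n) (N : nat) : 'M[R]_n :=
  (1 + N.+1%:R^-1 *: L) ^+ N.+1.

(** Differs from [transition_semigroup] in leaving the rows free: the transient block of a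
    stochastic semigroup may have row sums below one. *)
Definition semigroup_gen (R : realType) (n : nat) (L : 'M[R]_n)
    (f : R -> 'M[R]_n) : Prop :=
  [/\ f 0 = 1,
      forall s t, 0 <= s -> 0 <= t -> f (s + t) = f s * f t &
      forall j k, (f h j k - (1 : 'M[R]_n) j k) / h @[h --> 0^'+] --> L j k].

Lemma expRX1D (R : realType) (c : R) (k : nat) : 0 <= c ->
  (1 + k.+1%:R^-1 * c) ^+ k.+1 <= expR c.
Proof.
move=> c0; have e : c = k.+1%:R * (k.+1%:R^-1 * c) by rewrite mulVKf.
rewrite [leRHS](_ : _ = expR (k.+1%:R^-1 * c) ^+ k.+1); last first.
  by rewrite -expRM_natl -e.
apply: lerXn2r; rewrite ?nnegrE ?expR_ge0 ?expR_ge1Dx//.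
by rewrite addr_ge0// mulr_ge0// invr_ge0.
Qed.

Section Semigroup.
Variables (R : realType) (n : nat) (L : 'M[R]_n) (f : R -> 'M[R]_n).
Hypothesis fL : semigroup_gen L f.

Lemma semigroup_genX h k : 0 <= h -> f (k%:R * h) = f h ^+ k.
Proof.
case: fL => f0 fD _ h0; elim: k => [|k IH]; first by rewrite mul0r f0.
by rewrite -addn1 natrD mulrDl mul1r fD ?mulr_ge0// IH addn1 exprSr.
Qed.

Lemma semigroup_gen_near e : 0 < e ->
  \forall h \near 0^'+, row_bound (f h - (1 + h *: L)) (h * e).
Proof.
move=> e0; case: fL => _ _ fL'.
have n1 : 0 < n.+1%:R :> R by [].
near=> h.
have h0 : 0 < h by near: h; exact: nbhs_right_gt.
(* Each entry is kept within [e / n.+1], so that a row of n entries stays within [e]; the successor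
   also covers n = 0. *)
have H : forall j k, `|L j k - (f h j k - (1 : 'M[R]_n) j k) / h| <= e / n.+1%:R.
  near: h; apply: filter_forall => j; apply: filter_forall => k.
  by move/cvgrPdist_le: (fL' j k); apply; rewrite divr_gt0.
move=> i; apply: (@le_trans _ _ (\sum_(j < n) h * (e / n.+1%:R))); last first.
  rewrite sumr_const card_ord -[leLHS]mulr_natr -mulrA ler_pM2l//.
  by rewrite mulrAC ler_pdivrMr// ler_pM2l// ler_nat.
apply: ler_sum => j _; rewrite -ler_pdivrMl//.
have := H i j; rewrite distrC; congr (_ <= _).
rewrite !mxE -[X in _ = X * _]gtr0_norm ?invr_gt0// -normrM.
congr (`|_|); field.
by rewrite gt_eqF.
Unshelve. all: by end_near. Qed.

Lemma semigroup_gen_euler t i j : 0 < t ->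
  euler (t *: L) N i j @[N --> \oo] --> f t i j.
Proof.
move=> t0; have [C C0 LC] := row_bound_exists L.
apply/cvgrPdist_le => /= e e0.
(* With h = t / (N + 1), telescoping gives the error (N + 1) m^(N+1) h d = t m^(N+1) d for m = 1 + h
   (C + 1), and this is at most [K * d]. The bound [d <= 1] makes m a row bound for [f h] as
   well. *)
set K := t * expR (t * (C + 1)).
have K0 : 0 < K by rewrite mulr_gt0// expR_gt0.
pose d := Num.min 1 (e / K).
have d0 : 0 < d by rewrite lt_min ltr01 divr_gt0.
near=> N.
have : row_bound (f (N.+1%:R^-1 * t) - (1 + (N.+1%:R^-1 * t) *: L))
    (N.+1%:R^-1 * t * d).
  near: N.
  have hc : (N.+1%:R^-1 * t) @[N --> \oo] --> (0 : R).
    by rewrite -(mul0r t); apply: cvgMl; exact: cvg_harmonic.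
  have := hc _ (semigroup_gen_near d0).
  rewrite /nbhs/= => F; near=> N.
  have : 0 < N.+1%:R^-1 * t by rewrite mulr_gt0// invr_gt0.
  by near: N.
set h := N.+1%:R^-1 * t => H.
have h0 : 0 < h by rewrite mulr_gt0// invr_gt0.
have d1 : d <= 1 by rewrite ge_min lexx.
have hL : row_bound (1 + h *: L) (1 + h * C).
  apply: row_boundD; first exact: row_bound1.
  by rewrite -{2}(gtr0_norm h0); exact: row_boundZ.
have hL' : row_bound (1 + h *: L) (1 + h * (C + 1)).
  by apply: row_bound_le hL; rewrite lerD2l ler_pM2l// lerDl.
have hf : row_bound (f h) (1 + h * (C + 1)).
  rewrite -(subrK (1 + h *: L) (f h)).
  apply: row_bound_le (row_boundD H hL).
  by rewrite mulrDr mulr1 addrCA lerD2l addrC lerD2l ger_pMr.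
have -> : f t = f h ^+ N.+1 by rewrite -semigroup_genX ?ltW// mulVKf.
have -> : euler (t *: L) N = (1 + h *: L) ^+ N.+1 by rewrite /euler scalerA.
have m1 : 1 <= 1 + h * (C + 1) by rewrite lerDl mulr_ge0 ?addr_ge0// ltW.
have hd0 := ltW (mulr_gt0 h0 d0).
have := row_bound_entry i j (row_bound_subX N.+1 m1 hd0 hf hL' H).
rewrite mxE [X in _ + X]mxE; move/le_trans; apply.
rewrite (_ : _ * (h * d) = t * (1 + h * (C + 1)) ^+ N.+1 * d); last first.
  rewrite mulrAC mulrA (_ : N.+1%:R * h = t); last by rewrite mulVKf.
  by rewrite mulrAC.
apply: (@le_trans _ _ (K * d)); last first.
  by rewrite mulrC -ler_pdivlMr// ge_min lexx orbT.
rewrite ler_pM2r// ler_pM2l// /h -mulrA; apply: expRX1D.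
by rewrite mulr_ge0 ?addr_ge0// ltW.
Unshelve. all: by end_near. Qed.

End Semigroup.

(** * Euler products and the exponential series *)

Section ExpEuler.
Variable R : realType.

Lemma bernoulli_ineq (x : R) k : 0 <= x <= 1 -> 1 - k%:R * x <= (1 - x) ^+ k.
Proof.
move=> /andP[x0 x1]; elim: k => [|k IH]; first by rewrite mul0r subr0.
rewrite exprS; apply: le_trans (ler_wpM2l _ IH); last by rewrite subr_ge0.
rewrite -addn1 natrD; have : 0 <= k%:R * x * x by rewrite !mulr_ge0.
lra.
Qed.

Lemma cvg_expRX1D (c : R) : 0 <= c ->
  (1 + N.+1%:R^-1 * c) ^+ N.+1 @[N --> \oo] --> expR c.
Proof.
move=> c0.
apply: (@squeeze_cvgr _ _ _ _ (fun N => expR c * (1 - N.+1%:R^-1 * c ^+ 2))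
  (fun=> expR c)); last first.
- exact: cvg_cst.
- rewrite -[X in _ --> X]mulr1; apply: cvgMr.
  rewrite -[X in _ --> X]subr0; apply: cvgB; first exact: cvg_cst.
  by rewrite -(mul0r (c ^+ 2)); apply: cvgMl; exact: cvg_harmonic.
near=> N; rewrite expRX1D// andbT.
(* With y = c / (N + 1), (1 + y) >= e^y (1 - y^2) because e^-y >= 1 - y. *)
pose y := N.+1%:R^-1 * c.
have y0 : 0 <= y by rewrite mulr_ge0// invr_ge0.
have y1 : y <= 1.
  rewrite /y mulrC ler_pdivrMr// mul1r; apply: (@le_trans _ _ N%:R).
    by near: N; exact: nbhs_infty_ger.
  by rewrite ler_nat.
have ey : expR c = expR y ^+ N.+1 by rewrite -expRM_natl mulVKf.
have -> : N.+1%:R^-1 * c ^+ 2 = N.+1%:R * (y ^+ 2).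
  by rewrite /y; field; rewrite nat1r pnatr_eq0.
apply: (@le_trans _ _ (expR c * (1 - y ^+ 2) ^+ N.+1)).
  apply: ler_wpM2l; first exact: expR_ge0.
  by apply: bernoulli_ineq; rewrite exprn_ge0// exprn_ile1.
rewrite ey -exprMn; apply: lerXn2r; rewrite ?nnegrE.
- by rewrite mulr_ge0 ?expR_ge0// subr_ge0 exprn_ile1.
- by rewrite addr_ge0.
have := expR_ge1Dx (- y); rewrite expRN => h.
rewrite -ler_pdivlMl ?expR_gt0// -/y.
apply: le_trans (ler_wpM2r _ h); last by rewrite addr_ge0.
by rewrite le_eqVlt; apply/orP; left; apply/eqP; ring.
Unshelve. all: by end_near. Qed.

(** The k-th coefficient of the exponential series minus that of (1 + A / (N + 1))^(N+1). As it is
    nonnegative, the matrix estimate reduces to the scalar one. *)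
Let w N k : R := k`!%:R^-1 - (N.+1%:R^-1) ^+ k * 'C(N.+1, k)%:R.

(** ['C(M, k) * k!] is a falling factorial with k factors at most M, hence at most M^k. *)
Let w_ge0 N k : 0 <= w N k.
Proof.
rewrite /w subr_ge0 exprVn mulrC ler_pdivrMr ?exprn_gt0//.
rewrite mulrC ler_pdivlMr ?ltr0n ?fact_gt0// -natrM -natrX ler_nat bin_ffact.
elim: k N.+1 => [|k IH] M; first by rewrite ffactn0.
rewrite ffactnS expnS leq_mul// (leq_trans (IH _))//.
by case: k {IH} => // k; rewrite leq_exp2r// leq_pred.
Qed.

Let w_sum n (A : 'M[R]_n) N :
  \sum_(0 <= k < N.+2) k`!%:R^-1 *: A ^+ k - euler A N =
  \sum_(0 <= k < N.+2) w N k *: A ^+ k.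
Proof.
rewrite /euler [1 + _]addrC exprD1n -(big_mkord xpredT
  (fun k => (N.+1%:R^-1 *: A) ^+ k *+ 'C(N.+1, k))) -sumrB.
apply: eq_bigr => k _; rewrite scalerBl; congr (_ - _).
have exprZmx : forall x, (x *: A) ^+ k = x ^+ k *: A ^+ k.
  move=> x; elim: k => [|k IH]; first by rewrite !expr0 scale1r.
  by rewrite !exprS IH -[LHS]scalemxAl -[in LHS]scalemxAr scalerA.
by rewrite exprZmx; apply/matrixP => i j; rewrite mulmxnE !mxE mulrAC mulr_natr.
Qed.

Let w_sumr (c : R) N :
  \sum_(0 <= k < N.+2) w N k * c ^+ k =
  series (exp_coeff c) N.+2 - (1 + N.+1%:R^-1 * c) ^+ N.+1.
Proof.
rewrite /series/= [1 + _]addrC exprD1n -(big_mkord xpredT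
  (fun k => (N.+1%:R^-1 * c) ^+ k *+ 'C(N.+1, k))) -sumrB.
apply: eq_bigr => k _; rewrite /exp_coeff /w mulrBl; congr (_ - _).
  by rewrite mulrC.
by rewrite -[RHS]mulr_natr exprMn mulrAC.
Qed.

(** If c is a row bound of A, the entries of the partial sum minus the Euler product are dominated
    by the same difference for the number c, where both terms tend to [expR c]. *)
Lemma expmx_euler n (A : 'M[R]_n) i j (l : R) :
  euler A N i j @[N --> \oo] --> l -> expmx A i j = l.
Proof.
move=> Al; rewrite mxE; apply/cvg_lim => //.
have [c c0 Ac] := row_bound_exists A.
(* [euler A N] is a polynomial of degree N + 1, so it is matched with a partial sum of N + 2
   terms. *)
rewrite -(cvg_shiftn 2 _ (nbhs l)).
pose S N := (\sum_(0 <= k < N.+2) k`!%:R^-1 *: A ^+ k) i j.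
suff h : S N - euler A N i j @[N --> \oo] --> (0 : R).
  have {}h : S N - euler A N i j + euler A N i j @[N --> \oo] --> l.
    by rewrite -[X in _ --> X]add0r; exact: cvgD.
  apply: cvg_trans h; apply: near_eq_cvg; near=> N.
  by rewrite /= subrK /S addn2.
apply: norm_cvg0.
apply: (@squeeze_cvgr _ _ _ _ (fun=> 0)
  (fun N => series (exp_coeff c) N.+2 - (1 + N.+1%:R^-1 * c) ^+ N.+1)).
- near=> N; rewrite normr_ge0/= -w_sumr.
  have -> : S N - euler A N i j = \sum_(0 <= k < N.+2) w N k * (A ^+ k) i j.
    rewrite /S.
    transitivity ((\sum_(0 <= k < N.+2) w N k *: A ^+ k) i j).
      by rewrite -w_sum; rewrite [in RHS]mxE [X in _ = _ + X]mxE.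
    by rewrite summxE; apply: eq_bigr => k _; rewrite mxE.
  apply: le_trans (ler_norm_sum _ _ _) _; apply: ler_sum => k _.
  rewrite normrM ger0_norm// ler_wpM2l//.
  exact/row_bound_entry/row_boundX.
- exact: cvg_cst.
- rewrite -(subrr (expR c)); apply: cvgB; last exact: cvg_expRX1D.
  have : series (exp_coeff c) N @[N --> \oo] --> expR c.
    exact: is_cvg_series_exp_coeff.
  rewrite -(cvg_shiftn 2 _ (nbhs (expR c))); apply: cvg_trans.
  by apply: near_eq_cvg; near=> N; rewrite /= addn2.
Unshelve. all: by end_near. Qed.

End ExpEuler.

(** * The absorbing state and the transient block *)

Section Embedding.
Variable R : realType.

Lemma euler_absorbing n (L : 'M[R]_n) i N k :
  (forall l, L i l = 0) -> euler L N i k = (i == k)%:R.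
Proof.
move=> Li0; rewrite /euler; set A := 1 + _.
have Ai l : A i l = (i == l)%:R by rewrite !mxE Li0 mulr0 addr0.
elim: N.+1 => [|m IH]; first by rewrite expr0 mxE.
rewrite exprS mxE (bigD1 i)//= Ai eqxx mul1r IH big1 ?addr0// => l li.
by rewrite Ai eq_sym (negbTE li) mul0r.
Qed.

Lemma absorbing_generator_row n (S : 'M[R]_n) k :
  absorbing_generator S (absorbing n) k = 0.
Proof. by rewrite col_mxEd row_mx0 mxE. Qed.

(** The zero row of the generator makes the corresponding row of every Euler product a unit row, and
    this passes to the limit. *)
Lemma absorbing_stays n (S : 'M[R]_n) Q t k :
  semigroup_gen (absorbing_generator S) Q -> 0 <= t ->
  Q t (absorbing n) k = (absorbing n == k)%:R.
Proof.
move=> SQ; rewrite le_eqVlt => /predU1P[<-|t0].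
  by case: SQ => -> _ _; rewrite mxE.
have := @semigroup_gen_euler _ _ _ _ SQ t (absorbing n) k t0.
have L0 l : (t *: absorbing_generator S) (absorbing n) l = 0.
  by rewrite mxE absorbing_generator_row mulr0.
under eq_cvg do rewrite euler_absorbing//.
by move/cvg_lim => <-//; rewrite lim_cst.
Qed.

(** The absorbing row of [Q t] is a unit row, so the lower left block vanishes and the upper left
    blocks multiply among themselves. *)
Lemma transient_block n (S : 'M[R]_n) Q :
  semigroup_gen (absorbing_generator S) Q ->
  semigroup_gen S (fun t => ulsubmx (Q t)).
Proof.
move=> SQ; have [Q0 QD Q'] := SQ; split.
- by rewrite Q0; apply/matrixP => i j; rewrite !mxE (inj_eq (@lshift_inj _ _)).
- move=> s t s0 t0; rewrite QD//; apply/matrixP => i j; rewrite !mxE.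
  rewrite big_split_ord/= big_ord1 [X in _ + X]mulrC.
  rewrite (absorbing_stays _ SQ t0) -[RHS]addr0; congr (_ + _); last first.
    by rewrite /absorbing eq_rlshift mul0r.
  by apply: eq_bigr => k _; rewrite !mxE.
- move=> j k; have := Q' (lshift 1 j) (lshift 1 k).
  rewrite /absorbing_generator block_mxEul.
  rewrite (_ : (fun h => _) =
    (fun h => (ulsubmx (Q h) j k - (1 : 'M[R]_n) j k) / h))//.
  apply/funext => h.
  have -> : (1 : 'M[R]_(n + 1)) (lshift 1 j) (lshift 1 k) = (1 : 'M[R]_n) j k.
    by rewrite !mxE (inj_eq (@lshift_inj _ _)).
  by rewrite [X in _ = (X - _) / _]mxE [X in _ = (X - _) / _]mxE.
Qed.

End Embedding.

(** * Absorption by time t as a countable union *)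

Section AbsorptionTime.
Variable R : realType.

Lemma at_right_ball (P : set R) s : (\forall u \near s^'+, P u) ->
  exists2 e, 0 < e & forall u, s < u < s + e -> P u.
Proof.
rewrite near_withinE => /nbhs_ballP[e /= e0 He]; exists e => // u /andP[su ue].
by apply: He => //; rewrite /ball/= distrC gtr0_norm ?subr_gt0// ltrBlDl.
Qed.

(** A countable set of test times. It has to contain t itself, since a path first absorbed exactly
    at t shows nothing earlier. *)
Lemma dense_times (t : R) : 0 < t ->
  exists r : nat -> R, [/\ forall k, 0 < r k <= t, exists k, r k = t &
    forall q : rat, 0 < (ratr q : R) < t -> exists k, r k = ratr q].
Proof.
move=> t0; exists (fun k => if unpickle k is Some q then
  (if 0 < (ratr (q : rat) : R) < t then ratr q else t) else t); split.
- move=> k; case: unpickle => [q|]; last by rewrite t0 lexx.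
  by case: ifPn => [/andP[-> /ltW]//|_]; rewrite t0 lexx.
(* The code of the rational 0 fails the guard and therefore yields the default t. *)
- by exists (pickle (0 : rat)); rewrite pickleK rmorph0 ltxx.
- by move=> q qt; exists (pickle q); rewrite pickleK qt.
Qed.

(** By right-continuity a visit at some s < t is still seen at a rational time shortly after s.
    Hence the event lies in the sigma-algebra of the process. *)
Lemma absorption_time_le (Omega : Type) n (J : R -> Omega -> 'I_(n + 1)) t :
  0 < t ->
  (forall w s, 0 <= s -> \forall u \near s^'+, J u w = J s w) ->
  exists2 r : nat -> R, forall k, 0 < r k <= t &
    [set w | (absorption_time J w <= t%:E)%E] =
    \bigcup_k J (r k) @^-1` [set absorbing n].
Proof.
move=> t0 Jrc; have [r [r_bnd [kt rt] rq]] := dense_times t0.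
exists r => //.
apply/seteqP; split=> w /=; last first.
  move=> [k _ /= Jk]; have /andP[rk0 rkt] := r_bnd k.
  apply: (@le_trans _ _ (r k)%:E); last by rewrite lee_fin.
  rewrite /absorption_time; apply: ereal_inf_lbound.
  by exists (r k); [split|reflexivity].
move=> tau; have [Jt|Jt] := eqVneq (J t w) (absorbing n).
  by exists kt => //=; rewrite rt.
have [[s [s0 st] Js]|noJ] :=
    pselect (exists2 s, 0 < s /\ s < t & J s w = absorbing n).
  have [e e0 He] := at_right_ball (Jrc w s (ltW s0)).
  have : s < Num.min t (s + e) by rewrite lt_min st ltrDl.
  move=> /rat_in_itvoo[q]; rewrite in_itv/= lt_min => /and3P[sq qt qe].
  have [|k rk] := rq q; first by rewrite (lt_trans s0 sq) qt.
  by exists k => //=; rewrite rk He ?sq.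
(* Without a visit in (0, t], right-continuity at t also excludes visits in (t, t + e), so the
   infimum would be at least t + e, against [tau]. *)
have [e e0 He] := at_right_ball (Jrc w t (ltW t0)).
suff : ((t + e)%:E <= absorption_time J w)%E.
  by move=> /le_trans/(_ tau); rewrite lee_fin gerDl leNgt e0.
rewrite /absorption_time; apply: le_ereal_inf_tmp => _ [s [s0 Js] <-].
rewrite lee_fin leNgt; apply/negP => ste.
have [st|ts|st] := ltgtP s t.
- by apply: noJ; exists s.
- by move: Jt; rewrite -(He s) ?ts// Js eqxx.
- by move: Jt; rewrite -st Js eqxx.
Qed.

End AbsorptionTime.

(** * Laws of absorption times and conditioning on the initial state *)

Section Probability.
Variables (R : realType) (disp : measure_display) (Omega : measurableType disp).
Variable P : probability Omega R.

Lemma process_sigma_measurable n (J : R -> Omega -> 'I_n) A :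
  jump_process J -> process_sigma J [set t | 0 <= t] A -> measurable A.
Proof.
move=> [mJ _ _]; apply: smallest_sub; first exact: sigma_algebra_measurable.
by move=> _ [t [k [t0 ->]]]; exact: mJ.
Qed.

(** The event B contains A = {J_t absorbed}, and B minus A is null because the absorbing state is
    left with probability zero. The probability of A given the start j is the last entry of row j of
    the stochastic matrix [Q t], hence one minus the row sum of the transient block. *)
Lemma absorption_law n (S : 'M[R]_n) (J : R -> Omega -> 'I_(n + 1)) :
  markov_jump_process P (absorbing_generator S) J ->
  exists2 f, semigroup_gen S f & forall t, 0 < t ->
    let B := [set w | (absorption_time J w <= t%:E)%E] in
    process_sigma J [set u | 0 <= u] B /\
    forall j, P (B `&` J 0%R @^-1` [set lshift 1 j]) =
      (P (J 0%R @^-1` [set lshift 1 j]) * (1 - \sum_k f t j k)%:E)%E.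
Proof.
move=> [Jjump [Q [[Q0 QD Qprob Q'] Jmarkov]]].
have SQ : semigroup_gen (absorbing_generator S) Q by split.
have [mJ Jrc _] := Jjump.
exists (fun t => ulsubmx (Q t)); first exact: transient_block.
move=> t t0 B.
have [r r_bnd Br] := absorption_time_le t0 (fun w s => Jrc w s).
have sB : process_sigma J [set u | 0 <= u] B.
  rewrite /B Br; apply: sigma_algebra_bigcup => k; apply: sub_sigma_algebra.
  by exists (r k), (absorbing n); split=> //=; case/andP: (r_bnd k) => /ltW.
split=> // j; have mB := process_sigma_measurable Jjump sB.
set E := J 0 @^-1` _; have mE : measurable E by exact: mJ.
pose A := J t @^-1` [set absorbing n].
have mA : measurable A by apply: mJ; exact: ltW.
(* Taking the whole space as past event reduces the Markov property to the joint law at two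
   times. *)
have sT u : process_sigma J [set v | 0 <= v <= u] setT.
  have := @sigma_algebraCD _ _ _ _ (@sigma_algebra0 _ setT
    [set A | exists t k, (0 <= t <= u) /\ A = J t @^-1` [set k]]).
  by rewrite setD0.
have PAE : P (A `&` E) = (P E * (1 - \sum_k ulsubmx (Q t) j k)%:E)%E.
  have := Jmarkov 0 t setT (lshift 1 j) (absorbing n) (lexx _) (ltW t0) (sT 0).
  rewrite setTI add0r setIC => ->; congr (_ * _%:E)%E.
  have [_ ] := Qprob t (ltW t0) (lshift 1 j).
  rewrite big_split_ord/= big_ord1 mxE => <-.
  rewrite [in RHS]addrC -addrA -[LHS]addr0; congr (_ + _); apply/esym/eqP.
  by rewrite subr_eq0; apply/eqP/eq_bigr => k _; rewrite !mxE.
rewrite -PAE; have -> : B `&` E = (A `&` E) `|` ((B `\` A) `&` E).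
  rewrite -setIUl setDE; congr (_ `&` _); rewrite setUIr setUv setIT setUidr//.
  move=> w Aw; rewrite /B/= /absorption_time; apply: ereal_inf_lbound.
  by exists t; [split|reflexivity].
apply: measureU0; [exact: measurableI| |].
  by apply: measurableI => //; exact: measurableD.
apply/negligibleP; first by apply: measurableI => //; exact: measurableD.
(* It suffices to treat each test time: being absorbed at [r k] but not at t has probability zero,
   by the Markov property between [r k] and t. *)
apply: (@negligibleS _ _ _ _ (\bigcup_k (J (r k) @^-1` [set absorbing n] `\` A))).
  by move=> w [[]]; rewrite /B Br => -[k _ Jk] nA _; exists k.
apply: negligible_bigcup => k; have /andP[rk0 rkt] := r_bnd k.
have mJk : measurable (J (r k) @^-1` [set absorbing n]) by apply: mJ; exact: ltW.
apply/negligibleP; first exact: measurableD.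
have := Jmarkov (r k) (t - r k) setT (absorbing n) (absorbing n) (ltW rk0).
rewrite subr_ge0 => /(_ rkt (sT _)); rewrite setTI subrKC.
rewrite (absorbing_stays _ SQ) ?subr_ge0// eqxx mule1 => PJA.
rewrite measureD//.
  rewrite [X in (_ - X)%E](_ : _ = P (J (r k) @^-1` [set absorbing n])).
    by rewrite subee// fin_num_measure.
  exact: PJA.
by rewrite (le_lt_trans (probability_le1 _ _))// ltry.
Qed.

Lemma survival_law n (S : 'M[R]_n) (J : R -> Omega -> 'I_(n + 1)) :
  markov_jump_process P (absorbing_generator S) J ->
  exists2 f, semigroup_gen S f & forall t, 0 < t ->
    let B := [set w | (absorption_time J w <= t%:E)%E] in
    let C := [set w | (t%:E < absorption_time J w)%E] in
    [/\ process_sigma J [set u | 0 <= u] B,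
        process_sigma J [set u | 0 <= u] C,
        forall j, P (B `&` J 0%R @^-1` [set lshift 1 j]) =
          (P (J 0%R @^-1` [set lshift 1 j]) * (1 - \sum_k f t j k)%:E)%E &
        forall j, P (C `&` J 0%R @^-1` [set lshift 1 j]) =
          (P (J 0%R @^-1` [set lshift 1 j]) * (\sum_k f t j k)%:E)%E].
Proof.
move=> SJ; have [f Sf H] := absorption_law SJ.
exists f => // t t0 B C; have [sB PB] := H t t0.
have CB : C = setT `\` B.
  rewrite setTD; apply/seteqP; split=> w; rewrite /B /C /= => h.
    by apply/negP; rewrite -ltNge.
  by rewrite ltNge; apply/negP.
have [[mJ _ _] _] := SJ.
have mB : measurable B by apply: process_sigma_measurable sB; case: SJ.
split=> //; first by rewrite CB; exact: sigma_algebraCD.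
move=> j; set E := J 0 @^-1` _; have mE : measurable E by exact: mJ.
rewrite CB setTD setIC -setDE measureD//; last first.
  by rewrite (le_lt_trans (probability_le1 _ _))// ltry.
have PEe : P E = (fine (P E))%:E by rewrite fineK ?fin_num_measure.
transitivity ((fine (P E))%:E - (fine (P E))%:E * (1 - \sum_k f t j k)%:E)%E.
  congr (_ - _)%E; first exact: PEe.
  by rewrite -PEe setIC; exact: PB.
by rewrite [in RHS]PEe -!EFinM -EFinB; congr (_%:E); ring.
Qed.

(** The weights of the transient states already sum to one, so a start in the absorbing state has
    probability zero. *)
Lemma total_probability n (J0 : Omega -> 'I_(n + 1)) (a : 'rV[R]_n) A :
  (forall k, measurable (J0 @^-1` [set k])) -> probability_vector a ->
  (forall j, P (J0 @^-1` [set lshift 1 j]) = (a 0 j)%:E) -> measurable A ->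
  P A = (\sum_j P (A `&` J0 @^-1` [set lshift 1 j]))%E.
Proof.
move=> mJ0 [_ a1] Pa mA.
have split_start B : measurable B ->
    P B = (\sum_j P (B `&` J0 @^-1` [set lshift 1 j]) +
           P (B `&` J0 @^-1` [set absorbing n]))%E.
  move=> mB; have {1}-> : B = \big[setU/set0]_(k < n + 1) (B `&` J0 @^-1` [set k]).
      rewrite -bigcup_seq; apply/seteqP; split.
      by move=> w Bw; exists (J0 w) => //=; exact: mem_index_enum.
    by move=> w [k _ []].
  rewrite measure_bigsetU_ord.
  - by rewrite big_split_ord/= big_ord1.
  - by move=> k; exact: measurableI.
  - by move=> k l _ _ [w [[_ <-] [_ <-]]].
suff Pabs : P (J0 @^-1` [set absorbing n]) = 0%E.
  rewrite split_start// [X in (_ + X)%E](_ : _ = 0%E) ?adde0//.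
  apply: subset_measure0 Pabs; [exact: measurableI|exact: mJ0|].
  exact: subIsetr.
have := split_start setT measurableT.
rewrite probability_setT setTI; under eq_bigr do rewrite setTI Pa.
rewrite sumEFin a1.
have -> : P (J0 @^-1` [set absorbing n]) = (fine (P (J0 @^-1` [set absorbing n])))%:E.
  by rewrite fineK ?fin_num_measure.
by rewrite -EFinD => -[h]; congr (_%:E); lra.
Qed.

(** Serves the distribution and the survival function alike: [A i] becomes {X_i <= x_i} or {X_i >
    x_i}, and [c i j] its probability given the start j. *)
Lemma mPH_rect p d (pi : 'rV[R]_p) (T : 'I_d -> 'M[R]_p)
    (J : 'I_d -> R -> Omega -> 'I_(p + 1)) (A : 'I_d -> set Omega)
    (c : 'I_d -> 'I_p -> R) :
  (0 < d)%N -> probability_vector pi -> mPH_processes P pi T J ->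
  (forall i, process_sigma (J i) [set t | 0 <= t] (A i)) ->
  (forall i j, P (A i `&` J i 0 @^-1` [set lshift 1 j]) =
    (P (J i 0%R @^-1` [set lshift 1 j]) * (c i j)%:E)%E) ->
  P [set w | forall i, A i w] = (\sum_j pi 0 j * \prod_i c i j)%:E.
Proof.
move=> d0 pi_prob [Jm [J0 [JJ0 PJ0 indep]]] sA PA.
have Ji i k : J i 0 @^-1` [set k] = J0 @^-1` [set k].
  by apply/seteqP; split=> w /=; rewrite JJ0.
have mA i : measurable (A i).
  by apply: process_sigma_measurable (sA i); case: (Jm i).
have mJ0 k : measurable (J0 @^-1` [set k]).
  (* Measurability of [J0] is only available through some [J i 0]; [d0] supplies an index i. *)
  rewrite -(Ji (Ordinal d0)); have [[mJ _ _] _] := Jm (Ordinal d0).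
  exact: mJ.
have mIA : measurable [set w | forall i, A i w].
  rewrite (_ : [set w | _] = \bigcap_(i in [set: 'I_d]) A i).
    by apply: fin_bigcap_measurable => //; exact: finite_finset.
  by apply/seteqP; split=> w /= h i; [move=> _|]; exact: h.
rewrite (total_probability mJ0 pi_prob PJ0 mIA) -sumEFin.
apply: eq_bigr => j _; set E := J0 @^-1` _.
have mE : measurable E by exact: mJ0.
have PE : P E = (pi 0 j)%:E by exact: PJ0.
(* Conditional independence is silent about a start of probability zero; there both sides vanish. *)
have [pi0|pi_neq0] := eqVneq (pi 0 j) 0.
  rewrite pi0 mul0r; apply: (@subset_measure0 _ _ _ _ _ E) => //.
  - exact: measurableI.
  - by apply: (etrans PE); rewrite pi0.
have pi_gt0 : 0 < pi 0 j by rewrite lt_neqAle eq_sym pi_neq0 pi_prob.1.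
have := indep (lshift 1 j) A; rewrite -/E PE lte_fin => /(_ pi_gt0 sA).
rewrite /cond_prob PE /= => /(canRL (divfK pi_neq0)) H.
rewrite -[LHS]fineK ?fin_num_measure//; last exact: measurableI.
congr (_%:E); rewrite H mulrC; congr (_ * _); apply: eq_bigr => i _.
by have := PA i j; rewrite Ji -/E PE => ->; rewrite /= mulrAC divff// mul1r.
Qed.

End Probability.

(** * Kronecker products of semigroups *)

Section Kronecker.
Variable R : realType.

Lemma tens_scalar1 m n : (1%:M : 'M[R]_m) *t (1%:M : 'M[R]_n) = 1%:M.
Proof.
apply/matrixP => i j; case: (mxtens_indexP i) => i1 i2.
case: (mxtens_indexP j) => j1 j2; rewrite tensmxE !mxE.
by rewrite (can_eq (@mxtens_indexK _ _)) xpair_eqE -mulnb natrM.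
Qed.

(** Multiplicativity is the mixed-product property; the generator comes from the product rule at
    0. *)
Lemma semigroup_gen_tens m n (A : 'M[R]_m) (B : 'M[R]_n) f g :
  semigroup_gen A f -> semigroup_gen B g ->
  semigroup_gen (A *t 1%:M + 1%:M *t B) (fun t => f t *t g t).
Proof.
move=> [f0 fD f'] [g0 gD g']; split.
- by rewrite f0 g0; exact: tens_scalar1.
- by move=> s t s0 t0; rewrite fD// gD//; exact/esym/tensmx_mul.
move=> i j; case: (mxtens_indexP i) => i1 i2; case: (mxtens_indexP j) => j1 j2.
pose a h := (f h i1 j1 - (1 : 'M[R]_m) i1 j1) / h.
pose b h := (g h i2 j2 - (1 : 'M[R]_n) i2 j2) / h.
have -> : (A *t 1%:M + 1%:M *t B)
      (mxtens_index (i1, i2)) (mxtens_index (j1, j2)) =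
    A i1 j1 * (1%:M : 'M[R]_n) i2 j2 + (1%:M : 'M[R]_m) i1 j1 * B i2 j2.
  by rewrite mxE !tensmxE.
have h0 : (fun h : R => h) @ 0^'+ --> (0 : R).
  exact/cvg_at_right_filter/cvg_id.
(* Here f = 1 + h a and g = 1 + h b entrywise, and the difference quotient of f g is a g + 1 b, with
   g tending to the identity. *)
have : a h * ((1 : 'M[R]_n) i2 j2 + h * b h) + (1 : 'M[R]_m) i1 j1 * b h
      @[h --> 0^'+] -->
    A i1 j1 * (1%:M : 'M[R]_n) i2 j2 + (1%:M : 'M[R]_m) i1 j1 * B i2 j2.
  apply: cvgD; last by apply: cvgMr; exact: g'.
  apply: cvgM; first exact: f'.
  rewrite -[X in _ --> X]addr0; apply: cvgD; first exact: cvg_cst.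
  by rewrite -[X in _ --> X](mul0r (B i2 j2)); apply: (cvgM h0 (g' i2 j2)).
apply: cvg_trans; apply: near_eq_cvg; near=> h.
have hn0 : h != 0.
  by rewrite gt_eqF//; near: h; exact: nbhs_right_gt.
have -> : (1 : 'M[R]_(m * n)) (mxtens_index (i1, i2)) (mxtens_index (j1, j2)) =
    (1 : 'M[R]_m) i1 j1 * (1 : 'M[R]_n) i2 j2.
  by rewrite -tensmxE tens_scalar1.
rewrite tensmxE /a /b.
by field.
Unshelve. all: by end_near. Qed.

Lemma semigroup_gen_scale n (A : 'M[R]_n) f x : 0 < x ->
  semigroup_gen A f -> semigroup_gen (x *: A) (fun t => f (x * t)).
Proof.
move=> x0 [f0 fD f']; split; first by rewrite mulr0.
  by move=> s t s0 t0; rewrite mulrDr fD// mulr_ge0// ltW.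
(* The limit is tested on positive null sequences, which multiplication by x > 0 turns into positive
   null sequences. *)
move=> j k; rewrite [X in _ --> X]mxE; apply/cvg_at_rightP => u [u0 ul].
have /cvg_at_rightP/(_ (fun m => x * u m)) H := f' j k.
have {}H := H (conj (fun m => mulr_gt0 x0 (u0 m)) _).
have xu : x * u m @[m --> \oo] --> (0 : R).
  by rewrite -[X in _ --> X](mulr0 x); apply: cvgMr.
have : x * ((f (x * u m) j k - (1 : 'M[R]_n) j k) / (x * u m)) @[m --> \oo] -->
    x * A j k by apply: cvgMr; exact: H.
apply: cvg_trans; apply: near_eq_cvg; near=> m.
have um : u m != 0 by rewrite gt_eqF.
have xn0 : x != 0 by rewrite gt_eqF.
by field; rewrite um.
Unshelve. all: by end_near. Qed.

Fixpoint kron_prod (p d : nat) : ('I_d -> 'M[R]_p) -> 'M[R]_(powdim p d) :=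
  match d with
  | 0 => fun _ => 1%:M
  | d'.+1 => fun A => A ord0 *t kron_prod (fun i => A (lift ord0 i))
  end.

Lemma semigroup_gen_kron p d (T : 'I_d -> 'M[R]_p) (f : 'I_d -> R -> 'M[R]_p) :
  (forall i, semigroup_gen (T i) (f i)) ->
  semigroup_gen (kron_sum T) (fun t => kron_prod (fun i => f i t)).
Proof.
elim: d T f => [|d IH] T f Tf /=; last first.
  by apply: semigroup_gen_tens; [exact: Tf | apply: IH => i; exact: Tf].
split=> //; first by move=> *; rewrite [RHS]mul1mx.
move=> j k; rewrite [X in _ --> X]mxE; under eq_cvg do rewrite subrr mul0r.
exact: cvg_cst.
Qed.

(** The all-ones vector is itself a Kronecker product, so the mixed-product property splits off one
    scalar factor at a time. *)
Lemma kron_prod_sum p d (a : 'I_d -> 'rV[R]_p) (A : 'I_d -> 'M[R]_p) :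
  (kron_row a *m kron_prod A *m ones R _) 0 0 =
  \prod_i (a i *m A i *m ones R _) 0 0.
Proof.
elim: d a A => [|d IH] a A /=.
  by rewrite big_ord0 mulmx1 mxE big_ord1 !mxE mulr1.
have one_tens q r : (ones R (q * r) : 'M[R]_(q * r, 1 * 1)) = ones R q *t ones R r.
  by apply/matrixP => i j; rewrite !mxE mulr1.
rewrite big_ord_recl -IH; set r := kron_row _; set B := kron_prod _.
(* The dimensions are spelled out so that the outer 1 is read as [1 * 1], as [tensmx_mul]
   requires. *)
have E : @mulmx R (1 * 1) (p * powdim p d) (1 * 1) (a ord0 *t r *m (A ord0 *t B))
      (ones R (p * powdim p d)) =
    (a ord0 *m A ord0 *m ones R p) *t (r *m B *m ones R (powdim p d)).
  by rewrite one_tens !tensmx_mul.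
apply: (etrans (congr1 (fun M : 'M[R]_(1 * 1, 1 * 1) => M 0 0) E)).
rewrite mxE; case: (mxtens_unindex _) => i j /=.
by rewrite (ord1 i) (ord1 j).
Qed.

End Kronecker.

(** * Block-diagonal generators and the vector [pi_tilde] *)

Section BlockDiagonal.
Variable R : realType.

Lemma mulmx_onesE n (r : 'rV[R]_n) : (r *m ones R n) 0 0 = \sum_k r 0 k.
Proof. by rewrite mxE; apply: eq_bigr => k _; rewrite mxE mulr1. Qed.

Lemma cvg_euler_bilinear n (L : 'M[R]_n) f t (r : 'rV[R]_n) (v : 'cV[R]_n) :
  semigroup_gen L f -> 0 < t ->
  (r *m euler (t *: L) N *m v) 0 0 @[N --> \oo] --> (r *m f t *m v) 0 0.
Proof.
move=> Lf t0; pose F (M : 'M[R]_n) := \sum_j (\sum_k r 0 k * M k j) * v j 0.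
have FE M : (r *m M *m v) 0 0 = F M.
  by rewrite mxE; apply: eq_bigr => j _; rewrite mxE.
rewrite FE; under eq_cvg do rewrite FE; rewrite /F.
apply: cvg_big => [|j _]; first exact: add_continuous.
apply: cvgMl; apply: cvg_big => [|k _]; first exact: add_continuous.
by apply: cvgMr; exact: (semigroup_gen_euler Lf).
Qed.

(** Working with Euler products makes it unnecessary to know that the semigroup generated by a
    block-diagonal matrix is block-diagonal. *)
Lemma mxrow_euler p (q : 'I_p -> nat) (r : forall j, 'rV[R]_(q j))
    (B : forall j, 'M[R]_(q j)) N :
  (\mxrow_j r j) *m euler (\mxdiag_j B j) N = \mxrow_j (r j *m euler (B j) N).
Proof.
rewrite /euler; set c := N.+1%:R^-1.
elim: N.+1 => [|m IH].
  rewrite expr0 [LHS]mulmx1; apply/eq_mxrowP => j.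
  by rewrite expr0 mulmx1.
rewrite exprSr [LHS]mulmxA IH [LHS]mulmxDr mulmx1 -scalemxAr mul_mxrow_mxdiag.
transitivity (\mxrow_j (r j *m (1 + c *: B j) ^+ m +
    c *: (r j *m (1 + c *: B j) ^+ m *m B j))).
  by apply/matrixP => i k; rewrite !mxE.
apply/eq_mxrowP => j.
by rewrite exprSr [RHS]mulmxA [RHS]mulmxDr mulmx1 -scalemxAr.
Qed.

Lemma kron_prod1 p d : kron_prod (fun _ : 'I_d => 1%:M : 'M[R]_p) = 1%:M.
Proof. by elim: d => [//|d IH] /=; rewrite IH tens_scalar1. Qed.

Lemma kron_row_sum p d (a : 'I_d -> 'rV[R]_p) :
  \sum_k kron_row a 0 k = \prod_i \sum_k a i 0 k.
Proof.
rewrite -mulmx_onesE -[X in X *m _]mulmx1 -kron_prod1 kron_prod_sum.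
by apply: eq_bigr => i _; rewrite mulmx1 mulmx_onesE.
Qed.

Lemma kron_row_ge0 p d (a : 'I_d -> 'rV[R]_p) k :
  (forall i l, 0 <= a i 0 l) -> 0 <= kron_row a 0 k.
Proof.
elim: d a k => [|d IH] a k a0 /=; first by rewrite mxE.
rewrite mxE; case: (mxtens_unindex _) => i j /=.
by rewrite (ord1 i) (ord1 j) mulr_ge0// IH.
Qed.

Lemma basis_row_sum p (j : 'I_p) : \sum_k basis_row R j 0 k = 1.
Proof.
rewrite (bigD1 j)//= mxE !eqxx big1 ?addr0// => k kj.
by rewrite mxE (negbTE kj) andbF.
Qed.

Lemma sum_mxrow p (q : 'I_p -> nat) (r : forall j, 'rV[R]_(q j)) :
  \sum_k (\mxrow_j r j) 0 k = \sum_j \sum_k r j 0 k.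
Proof.
rewrite -mulmx_onesE /ones -mxcol_const mul_mxrow_mxcol summxE.
by apply: eq_bigr => j _; rewrite mulmx_onesE.
Qed.

Lemma probability_vector_pi_tilde p d (pi : 'rV[R]_p) :
  probability_vector pi -> probability_vector (pi_tilde d pi).
Proof.
move=> [pi0 pi1]; split=> [k|].
  rewrite !mxE mulr_ge0// kron_row_ge0// => i l; rewrite mxE ler0n//.
rewrite sum_mxrow -[RHS]pi1; apply: eq_bigr => j _.
under eq_bigr do rewrite mxE.
rewrite -mulr_sumr kron_row_sum big1 ?mulr1// => i _; exact: basis_row_sum.
Qed.

(** For every N the Euler product of [T_of T x] splits over the blocks, so both sides are limits of
    one sequence. On each block the limit factorises by [kron_prod_sum]. *)
Lemma pi_tilde_survival p d (pi : 'rV[R]_p) (T : 'I_d -> 'M[R]_p) f g x :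
  (forall i, semigroup_gen (T i) (f i)) -> (forall i, 0 < x i) ->
  semigroup_gen (T_of T x) g ->
  \sum_k pi_tilde d pi 0 k * (\sum_l g 1 k l) =
  \sum_j pi 0 j * \prod_i \sum_k f i (x i) j k.
Proof.
move=> Tf x0 Tg.
(* Time is rescaled by x_i in the i-th factor, so that [h 1] contains [f i (x i)]. *)
pose h t := kron_prod (fun i => f i (x i * t)).
have Th : semigroup_gen (kron_sum (fun i => x i *: T i)) h.
  by apply: semigroup_gen_kron => i; exact: semigroup_gen_scale.
pose e (j : 'I_p) := kron_row (fun _ : 'I_d => basis_row R j).
have H1 := @cvg_euler_bilinear _ _ _ _ (pi_tilde d pi) (ones R _) Tg ltr01.
have H2 : \sum_j pi 0 j * (e j *m euler (1 *: kron_sum (fun i => x i *: T i)) N *m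
    ones R _) 0 0 @[N --> \oo] --> \sum_j pi 0 j * (e j *m h 1 *m ones R _) 0 0.
  apply: cvg_big => [|j _]; first exact: add_continuous.
  by apply: cvgMr; exact: cvg_euler_bilinear.
have E N : (pi_tilde d pi *m euler (1 *: T_of T x) N *m ones R _) 0 0 =
    \sum_j pi 0 j * (e j *m euler (1 *: kron_sum (fun i => x i *: T i)) N *m
    ones R _) 0 0.
  rewrite !scale1r mxrow_euler mulmx_onesE sum_mxrow; apply: eq_bigr => j _.
  by rewrite -mulmx_onesE -!scalemxAl mxE.
move: H1; under eq_cvg do rewrite E.
move=> /(cvg_unique (@Rhausdorff R)) => /(_ _ H2) H1.
transitivity ((pi_tilde d pi *m g 1 *m ones R _) 0 0).
  rewrite -mulmxA mxE; apply: eq_bigr => k _; congr (_ * _).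
  by rewrite mxE; apply: eq_bigr => l _; rewrite mxE mulr1.
rewrite H1; apply: eq_bigr => j _; congr (_ * _).
rewrite kron_prod_sum; apply: eq_bigr => i _.
by rewrite mulr1 mulmx_onesE -rowE; apply: eq_bigr => k _; rewrite mxE.
Qed.

End BlockDiagonal.

(** * Invertibility by a minimum principle *)

Section SubIntensity.
Variable R : realType.

(** The witness solves S v = -1; in probabilistic terms it is the vector of mean absorption times.
    If its minimum, at i, were at most 0, then (S v)_i would be at least v_i times the i-th row sum,
    hence nonnegative. *)
Lemma sub_intensity_supersolution n (S : 'M[R]_n) : transient_sub_intensity S ->
  exists2 v : 'cV[R]_n, forall j, 0 < v j 0 & forall j, (S *m v) j 0 < 0.
Proof.
move=> [[Soff Sdiag Srow] Sunit].
pose v : 'cV[R]_n := - (invmx S *m ones R n).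
have Sv : S *m v = - ones R n by rewrite mulmxN mulKVmx.
exists v => [j0|j]; last by rewrite Sv !mxE oppr_lt0 ltr01.
have [i _ vi] := arg_minP (fun i => v i 0) (erefl : xpredT j0).
apply: lt_le_trans (vi j0 isT); rewrite ltNge; apply/negP => vi0.
have : (S *m v) i 0 < 0 by rewrite Sv !mxE oppr_lt0 ltr01.
apply/negP; rewrite -leNgt mxE.
apply: (@le_trans _ _ (\sum_k S i k * v i 0)).
  by rewrite -mulr_suml mulr_le0.
rewrite (bigD1 i)//= [leRHS](bigD1 i)//= lerD2l.
by apply: ler_sum => k ki; rewrite ler_wpM2l ?vi// Soff// eq_sym.
Qed.

(** Let S u = 0 with u nonzero, and let |u_k| / v_k be maximal at i with value c. Then w = c v -
    sg(u_i) u is nonnegative and vanishes at i, so (S w)_i >= 0; but S w = c S v is negative. *)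
Lemma unitmx_supersolution n (S : 'M[R]_n) (v : 'cV[R]_n) :
  (forall j k, j != k -> 0 <= S j k) -> (forall j, 0 < v j 0) ->
  (forall j, (S *m v) j 0 < 0) -> S \in unitmx.
Proof.
move=> Soff v0 Sv.
suff kerS (u : 'cV[R]_n) : S *m u = 0 -> u = 0.
  (* [kermx] is the left kernel, whence the transpose. *)
  rewrite -unitmx_tr -row_free_unit -kermx_eq0; apply/rowV0P => u /sub_kermxP uS.
  apply: trmx_inj; rewrite trmx0; apply: kerS.
  by rewrite -[S]trmxK -trmx_mul uS trmx0.
move=> Su.
apply/matrixP => j0 o; rewrite (ord1 o) [RHS]mxE {o}; apply/eqP.
apply: contraT => uj0.
have [i _ ci] := arg_maxP (fun i => `|u i 0| / v i 0) (erefl : xpredT j0).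
set c := `|u i 0| / v i 0 in ci.
have c0 : 0 < c.
  by apply: lt_le_trans (ci j0 isT); rewrite divr_gt0// normr_gt0.
have cu k : `|u k 0| <= c * v k 0.
  by rewrite -ler_pdivrMr//; exact: ci.
pose s := Num.sg (u i 0).
pose w : 'cV[R]_n := c *: v - s *: u.
have wi : w i 0 = 0.
  by rewrite !mxE -normrEsg /c divfK ?subrr// gt_eqF.
have w0 k : 0 <= w k 0.
  rewrite !mxE subr_ge0; apply: le_trans (cu k).
  apply: le_trans (ler_norm _) _; rewrite normrM normr_sg.
  by rewrite ler_piMl// lern1 leq_b1.
have : (S *m w) i 0 < 0.
  rewrite mulmxBr -!scalemxAr Su scaler0 subr0 mxE pmulr_rlt0//.
apply/contraTT => _; rewrite -leNgt mxE (bigD1 i)//= wi mulr0 add0r.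
by apply: sumr_ge0 => k ki; rewrite mulr_ge0// Soff// eq_sym.
Qed.

(* Closed under Kronecker sums, and satisfied by the empty one, which is the
   singular 1 x 1 zero matrix. *)
Definition weak_sub_intensity n (S : 'M[R]_n) : Prop :=
  [/\ forall j k, j != k -> 0 <= S j k, forall j, S j j <= 0,
      forall j, \sum_k S j k <= 0 &
      exists2 v : 'cV[R]_n, forall j, 0 < v j 0 & forall j, (S *m v) j 0 <= 0].

Lemma transient_weak n (S : 'M[R]_n) :
  transient_sub_intensity S -> weak_sub_intensity S.
Proof.
move=> tS; have [[Soff Sdiag Srow] _] := tS; split=> //.
  by move=> j; exact: ltW.
have [v v0 Sv] := sub_intensity_supersolution tS.
by exists v => // j; exact: ltW.
Qed.

(** The product rule for a Kronecker sum acting on a tensor v (x) w; used for supersolutions and,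
    with all-ones vectors, for row sums. *)
Lemma mulmx_tens_add m n (A : 'M[R]_m) (B : 'M[R]_n)
    (v : 'cV[R]_m) (w : 'cV[R]_n) i k :
  \sum_l (A *t 1%:M + 1%:M *t B) (mxtens_index (i, k)) l *
    (v (mxtens_unindex l).1 0 * w (mxtens_unindex l).2 0) =
  (A *m v) i 0 * w k 0 + v i 0 * (B *m w) k 0.
Proof.
have := congr1 (fun M : 'M[R]_(m * n, 1 * 1) =>
  M (mxtens_index (i, k)) (mxtens_index (0, 0)))
  (mulmxDl (A *t 1%:M) (1%:M *t B) (v *t w)).
rewrite !tensmx_mul !mul1mx [in X in _ = X -> _]mxE !tensmxE => <-.
rewrite [in RHS]mxE; apply: eq_bigr => l _; congr (_ * _).
by rewrite mxE mxtens_indexK.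
Qed.

(** The tensor of the two supersolutions is again one, and the strict inequality for A alone makes
    it strict. *)
Lemma transient_tens m n (A : 'M[R]_m) (B : 'M[R]_n) :
  transient_sub_intensity A -> weak_sub_intensity B ->
  transient_sub_intensity (A *t 1%:M + 1%:M *t B).
Proof.
move=> tA [Boff Bdiag Brow [w w0 Bw]]; have [[Aoff Adiag Arow] _] := tA.
have [v v0 Av] := sub_intensity_supersolution tA.
set K := _ + _.
have KE i1 i2 j1 j2 : K (mxtens_index (i1, i2)) (mxtens_index (j1, j2)) =
    A i1 j1 * (i2 == j2)%:R + (i1 == j1)%:R * B i2 j2.
  by rewrite mxE !tensmxE !mxE.
have Koff i j : i != j -> 0 <= K i j.
  case: (mxtens_indexP i) => i1 i2; case: (mxtens_indexP j) => j1 j2.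
  rewrite (can_eq (@mxtens_indexK _ _)) xpair_eqE KE.
  have [->|i1j1] := eqVneq i1 j1; last by rewrite mul0r addr0 mulr_ge0// Aoff.
  have [//|i2j2] := eqVneq i2 j2; by rewrite mulr0 add0r mul1r Boff.
split; last first.
  pose z : 'cV[R]_(m * n) :=
    \col_l (v (mxtens_unindex l).1 0 * w (mxtens_unindex l).2 0).
  apply: (@unitmx_supersolution _ _ z) => // i; first by rewrite mxE mulr_gt0.
  rewrite mxE; case: (mxtens_indexP i) => i1 i2.
  under eq_bigr do rewrite [X in _ * X]mxE.
  rewrite /K mulmx_tens_add; have := Av i1; have := w0 i2; have := v0 i1.
  have := Bw i2; nra.
split=> // i; case: (mxtens_indexP i) => i1 i2.
  by rewrite KE !eqxx mulr1 mul1r; have := Adiag i1; have := Bdiag i2; lra.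
have := mulmx_tens_add A B (ones R m) (ones R n) i1 i2.
under eq_bigr do rewrite [X in _ * (X * _)]mxE [X in _ * (_ * X)]mxE !mulr1.
move=> ->.
rewrite !mxE mulr1 mul1r.
under eq_bigr do rewrite mxE mulr1.
under [X in _ + X]eq_bigr do rewrite mxE mulr1.
by have := Arow i1; have := Brow i2; lra.
Qed.

Lemma weak_kron_sum p d (T : 'I_d -> 'M[R]_p) :
  (forall i, transient_sub_intensity (T i)) -> weak_sub_intensity (kron_sum T).
Proof.
elim: d T => [|d IH] T tT /=.
  split; first by move=> j k; rewrite mxE.
  - by move=> j; rewrite mxE.
  - by move=> j; rewrite big1// => k _; rewrite mxE.
  - exists (const_mx 1) => j; first by rewrite mxE.
    by rewrite mul0mx mxE.
by apply/transient_weak/transient_tens => //; exact: IH.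
Qed.

(** The first factor provides strictness; the others enter through [weak_kron_sum], which for d = 1
    is the empty sum. *)
Lemma transient_kron_sum p d (T : 'I_d -> 'M[R]_p) : (0 < d)%N ->
  (forall i, transient_sub_intensity (T i)) ->
  transient_sub_intensity (kron_sum T).
Proof.
case: d T => [//|d] T _ tT /=.
by apply: transient_tens => //; exact: weak_kron_sum.
Qed.

Lemma transient_scale n (S : 'M[R]_n) x : 0 < x ->
  transient_sub_intensity S -> transient_sub_intensity (x *: S).
Proof.
move=> x0 [[Soff Sdiag Srow] Su]; split; last first.
  by rewrite unitmxZ// unitfE gt_eqF.
split.
- by move=> j k jk; rewrite mxE mulr_ge0 ?Soff// ltW.
- by move=> j; rewrite mxE pmulr_rlt0.
- move=> j; under eq_bigr do rewrite mxE.
  by rewrite -mulr_sumr pmulr_rle0.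
Qed.

(** With blocks of equal size the cast [conform_mx] disappears, leaving an entry formula free of
    dependent types. *)
Lemma mxdiag_constE p q (B : 'M[R]_q) k l :
  (\mxdiag_(j < p) B) k l =
  if tagnat.sig1 k == tagnat.sig1 l then B (tagnat.sig2 k) (tagnat.sig2 l) else 0.
Proof.
by rewrite mxE; case: ifP => _; rewrite ?conform_mx_id// mxE.
Qed.

(** Stacking p copies of a supersolution of B gives one for the block-diagonal matrix. *)
Lemma transient_mxdiag p q (B : 'M[R]_q) :
  transient_sub_intensity B -> transient_sub_intensity (\mxdiag_(j < p) B).
Proof.
move=> tB; have [[Boff Bdiag Brow] _] := tB.
have [v v0 Bv] := sub_intensity_supersolution tB.
have Doff k l : k != l -> 0 <= (\mxdiag_(j < p) B) k l.
  move=> kl; rewrite mxdiag_constE; case: ifPn => // /eqP e; apply: Boff.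
  apply: contra kl => /eqP e2; rewrite -(tagnat.sig2K k) -(tagnat.sig2K l).
  move: (tagnat.sig1 l) (tagnat.sig2 l) e e2 => j b e; case: _ / e b => b <-.
  exact: eqxx.
split; last first.
  apply: (@unitmx_supersolution _ _ (\mxcol_(j < p) v)) => // k.
    by rewrite mxE.
  by rewrite mul_mxdiag_mxcol mxE.
split=> // k; first by rewrite mxdiag_constE eqxx.
have -> : \sum_l (\mxdiag_(j < p) B) k l =
    ((\mxdiag_(j < p) B) *m const_mx 1 : 'cV[R]_(\sum_(j < p) q)) k 0.
  by rewrite mxE; apply: eq_bigr => l _; rewrite [X in _ * X]mxE mulr1.
rewrite -mxcol_const mul_mxdiag_mxcol mxE mxE.
by under eq_bigr do rewrite mxE mulr1.
Qed.

End SubIntensity.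

(** * Distribution and survival functions, and the conclusion *)

Lemma PH_survival (R : realType) (disp : measure_display)
    (Omega : measurableType disp) (P : probability Omega R) (q : nat)
    (alpha : 'rV[R]_q) (S : 'M[R]_q) (Y : {RV P >-> \bar R}) :
  probability_vector alpha -> PH alpha S Y ->
  exists2 g, semigroup_gen S g & forall t, 0 < t ->
    P [set w | (t%:E < Y w)%E] = (\sum_k alpha 0 k * \sum_l g t k l)%:E.
Proof.
move=> alpha1 [d' [Om' [P' [K [Kmarkov K0 YK]]]]].
have [g Sg H] := survival_law Kmarkov; exists g => // t t0.
have [_ sC _ PC] := H t t0; have [Kjump _] := Kmarkov.
have mY : measurable [set y : \bar R | (t%:E < y)%E].
  by rewrite -set_itvoy; exact: emeasurable_itv.
rewrite (YK _ mY) (total_probability _ alpha1 K0) -?sumEFin.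
- by apply: eq_bigr => k _; apply: (etrans (PC k)); rewrite K0.
- by move=> k; case: Kjump => mK _ _; exact: mK.
- exact: process_sigma_measurable sC.
Qed.

Lemma mPH_cdf_survival (R : realType) (disp : measure_display)
    (Omega : measurableType disp) (P : probability Omega R) (p d : nat)
    (pi : 'rV[R]_p) (T : 'I_d -> 'M[R]_p) (X : 'I_d -> {RV P >-> \bar R}) :
  (0 < d)%N -> probability_vector pi -> mPH pi T X ->
  exists2 f : 'I_d -> R -> 'M[R]_p, forall i, semigroup_gen (T i) (f i) &
    forall x, (forall i, 0 < x i) ->
      joint_cdf X x =
        (\sum_j pi 0 j * \prod_i (1 - \sum_k f i (x i) j k))%:E /\
      joint_survival X x =
        (\sum_j pi 0 j * \prod_i \sum_k f i (x i) j k)%:E.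
Proof.
move=> d0 pi1 [d' [Om' [P' [J [JmPH XJ]]]]].
have [Jmarkov _] := JmPH.
have /choice[f Hf] : forall i, exists f, semigroup_gen (T i) f /\ forall t, 0 < t ->
    let B := [set w | (absorption_time (J i) w <= t%:E)%E] in
    let C := [set w | (t%:E < absorption_time (J i) w)%E] in
    [/\ process_sigma (J i) [set u | 0 <= u] B,
        process_sigma (J i) [set u | 0 <= u] C,
        forall j, P' (B `&` J i 0%R @^-1` [set lshift 1 j]) =
          (P' (J i 0%R @^-1` [set lshift 1 j]) * (1 - \sum_k f t j k)%:E)%E &
        forall j, P' (C `&` J i 0%R @^-1` [set lshift 1 j]) =
          (P' (J i 0%R @^-1` [set lshift 1 j]) * (\sum_k f t j k)%:E)%E].
  by move=> i; have [f Tf Hf] := survival_law (Jmarkov i); exists f.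
exists f => [i|x x0]; first by case: (Hf i).
split.
  rewrite /joint_cdf (XJ (fun i => [set y | (y <= (x i)%:E)%E])); last first.
    by move=> i; rewrite -set_itvNyc; exact: emeasurable_itv.
  apply: (mPH_rect (A := fun i => [set w | (absorption_time (J i) w <= (x i)%:E)%E])
    d0 pi1 JmPH) => i.
    by have [_ /(_ _ (x0 i))[]] := Hf i.
  by have [_ /(_ _ (x0 i))[]] := Hf i.
rewrite /joint_survival (XJ (fun i => [set y | ((x i)%:E < y)%E])); last first.
  by move=> i; rewrite -set_itvoy; exact: emeasurable_itv.
apply: (mPH_rect (A := fun i => [set w | ((x i)%:E < absorption_time (J i) w)%E])
  d0 pi1 JmPH) => i.
  by have [_ /(_ _ (x0 i))[]] := Hf i.
by have [_ /(_ _ (x0 i))[]] := Hf i.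
Qed.

Theorem proposition2p4 (R : realType) (disp : measure_display)
    (Omega : measurableType disp) (P : probability Omega R) (p d : nat)
    (d_gt0 : (0 < d)%N)
    (pi : 'rV[R]_p) (T : 'I_d -> 'M[R]_p)
    (pi_prob : probability_vector pi)
    (T_sub : forall i, transient_sub_intensity (T i))
    (X : 'I_d -> {RV P >-> \bar R}) (X_mPH : mPH pi T X) :
  (forall x : 'I_d -> R, (forall i, 0 < x i) ->
    joint_cdf X x =
    (\sum_(j < p) pi 0 j * \prod_(i < d)
       (1 - (basis_row R j *m expmx (x i *: T i) *m ones R p) 0 0))%:E) /\
  (forall x : 'I_d -> R, (forall i, 0 < x i) ->
    [/\ probability_vector (pi_tilde d pi),
        transient_sub_intensity (T_of T x) &
        forall (disp' : measure_display) (Omega' : measurableType disp')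
          (P' : probability Omega' R) (Y : {RV P' >-> \bar R}),
          PH (pi_tilde d pi) (T_of T x) Y ->
          joint_survival X x = P' [set w | (1 < Y w)%E]]).
Proof.
have [f Tf FS] := mPH_cdf_survival d_gt0 pi_prob X_mPH.
split=> x x0; have [FX SX] := FS x x0.
  rewrite FX; congr (_%:E); apply: eq_bigr => j _; congr (_ * _); apply: eq_bigr => i _.
  congr (1 - _); rewrite mulmx_onesE; apply: eq_bigr => k _.
  (* [f i (x i)] and the exponential are limits of the same Euler products. *)
  rewrite -rowE [RHS]mxE; apply/esym/expmx_euler.
  exact: (semigroup_gen_euler (Tf i)).
have pi1 := probability_vector_pi_tilde d pi_prob.
split=> //.
  by apply/transient_mxdiag/transient_kron_sum => // i; exact: transient_scale.
move=> disp' Omega' P' Y YPH; have [g Tg ->//] := PH_survival pi1 YPH.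
by rewrite SX (pi_tilde_survival pi Tf x0 Tg).
Qed.
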